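(* Let $t\in\left(\tfrac12,1\right)$ and let $f(z)=z+\sum_{n=2}^{\infty}a_nz^n$ be in the class $Q_\Sigma(G,0,t)=N_\Sigma(G,t)$, where $G(t,z)=\frac{1}{1-2tz+z^2}$. Then $$|a_2a_4-a_3^2|\le 8t^2.$$
   Context: Let $U=\{z\in\mathbb{C}:|z|<1\}$. $A$ is the class of functions $f(z)=z+\sum_{n=2}^\infty a_nz^n$ analytic in $U$, and $S$ is the subclass of functions univalent in $U$. Every $f\in S$ has an inverse $f^{-1}$ with $f^{-1}(f(z))=z$ for $z\in U$ and $f(f^{-1}(w))=w$ for $w\in D_{r_0}=\{w\in\mathbb{C}:|w|<r_0(f)\}$, where $r_0(f)\ge 1/4$. A function $f\in A$ is called bi-univalent in $U$ if both $f$ and $f^{-1}$ are univalent in their domains of definition ($U$ and $D_{r_0}$); $\Sigma$ denotes the class of bi-univalent functions. Subordination: for $F$ analytic in $U$, $F(z)\prec\phi(z)$, $z\in U$, means there is an analytic function $\omega:U\to U$ with $\omega(0)=0$, $|\omega(z)|<1$ and $F(z)=\phi(\omega(z))$; for $F$ analytic in $D_{r_0}$, $F(w)\prec\phi(w)$, $w\in D_{r_0}$, means there is an analytic function $\varpi:D_{r_0}\to D_{r_0}$ with $\varpi(0)=0$, $|\varpi(w)|<1$ and $F(w)=\phi(\varpi(w))$. For $t\in(\tfrac12,1)$, $G(t,z)=\frac{1}{1-2tz+z^2}$, $z\in U$. A function $f\in\Sigma$ is in the class $N_\Sigma(G,t)=Q_\Sigma(G,0,t)$ if $$\frac{f(z)}{z}\prec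 G(t,z),\ z\in U,\qquad\text{and}\qquad \frac{g(w)}{w}\prec G(t,w),\ w\in D_{r_0},$$ where $g=f^{-1}$ (the quotients take the value $1$ at the origin). *)

(* Defs.v *)
From Stdlib Require Import Reals.
From Coquelicot Require Import Coquelicot.
Open Scope R_scope.

(* Functions on a disc are represented by total functions C -> C, whose values
   outside the disc are never used. *)
Definition disc (r : R) (z : C) : Prop := Cmod z < r.

Definition analytic_on (D : C -> Prop) (f : C -> C) : Prop :=
  forall z0 : C, D z0 ->
    exists (c : nat -> C) (delta : R), 0 < delta /\
      forall z : C, Cmod (z - z0) < delta -> is_pseries c (z - z0)%C (f z).

Definition univalent_on (D : C -> Prop) (f : C -> C) : Prop :=
  analytic_on D f /\
  forall z1 z2 : C, D z1 -> D z2 -> f z1 = f z2 -> z1 = z2.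

(* f(z) = z + a_2 z^2 + a_3 z^3 + ... for |z| < 1. *)
Definition normalized_expansion (f : C -> C) (a : nat -> C) : Prop :=
  a 0%nat = RtoC 0 /\ a 1%nat = RtoC 1 /\
  forall z : C, disc 1 z -> is_pseries a z (f z).

Definition class_A (f : C -> C) : Prop :=
  analytic_on (disc 1) f /\ exists a : nat -> C, normalized_expansion f a.

Definition class_S (f : C -> C) : Prop :=
  class_A f /\ univalent_on (disc 1) f.

(* g plays the role of f^{-1}, defined on f(U), which contains the disc of
   radius r0.  The inverse takes its values in U, hence the condition
   disc 1 (g w). *)
Definition inverse_on (f g : C -> C) (r0 : R) : Prop :=
  1 / 4 <= r0 /\
  (forall z : C, disc 1 z -> g (f z) = z) /\
  (forall w : C, disc r0 w -> disc 1 (g w) /\ f (g w) = w).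

Definition bi_univalent (f g : C -> C) (r0 : R) : Prop :=
  class_S f /\ inverse_on f g r0 /\ univalent_on (disc r0) g.

Definition class_Sigma (f : C -> C) : Prop :=
  exists (g : C -> C) (r0 : R), bi_univalent f g r0.

Definition subordinate (r : R) (F phi : C -> C) : Prop :=
  analytic_on (disc r) F /\
  exists omega : C -> C,
    analytic_on (disc r) omega /\
    omega (RtoC 0) = RtoC 0 /\
    (forall z : C, disc r z ->
       disc r (omega z) /\ Cmod (omega z) < 1 /\ F z = phi (omega z)).

Definition G (t : R) (z : C) : C := (1 / (1 - 2 * t * z + z ^ 2))%C.

Definition quot (f : C -> C) (z : C) : C :=
  if Ceq_dec z (RtoC 0) then RtoC 1 else (f z / z)%C.

Definition N_Sigma (t : R) (f : C -> C) : Prop :=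
  class_Sigma f /\
  exists (g : C -> C) (r0 : R),
    bi_univalent f g r0 /\
    subordinate 1 (quot f) (G t) /\
    subordinate r0 (quot g) (G t).

(* Main.v *)
Require Import Defs.
From Stdlib Require Import Reals Lra Lia.
From Stdlib Require Import Classical ClassicalEpsilon.
From Coquelicot Require Import Coquelicot.
Open Scope R_scope.

(* Write f(z)/z = G(t, w(z)) with w = c_1 z + c_2 z^2 + ... a Schwarz function.
   Comparing coefficients, and using U_1 U_3 - U_2^2 = -1 for the Chebyshev
   polynomials,
     a_2 a_4 - a_3^2 = 4 t^2 (c_1 c_3 - c_2^2) - c_1^4.
   Let w_k be the part of w with exponents congruent to k modulo 4, obtained by
   averaging over the rotations z -> i^j z; by Parseval on the four rotated
   points, |w_1|^2 + |w_2|^2 + |w_3|^2 <= 1.  Hence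
     W = 4 t^2 (w_1 w_3 - w_2^2) - w_1^4
   satisfies |W| <= 4 t^2 + 1 <= 8 t^2, and W/z^4 takes the value
   a_2 a_4 - a_3^2 at 0, so the maximum principle concludes.  The maximum
   principle is proved for functions with a second-order expansion and cubic
   remainder at every point, a class stable under the operations used, so that
   no Cauchy theory is needed. *)

(** * Orders of vanishing at the origin *)

Definition bigO (n : nat) (f : C -> C) : Prop :=
  exists K d : R, 0 <= K /\ 0 < d /\
    forall h : C, Cmod h < d -> Cmod (f h) <= K * Cmod h ^ n.

Lemma bigO_ext (n : nat) (f g : C -> C) :
  (forall h, f h = g h) -> bigO n f -> bigO n g.
Proof.
  intros E (K & d & HK & Hd & H); exists K, d; repeat split; auto.
  intros h Hh; rewrite <- E; auto.
Qed.

Lemma bigO_const (c : C) : bigO 0 (fun _ => c).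
Proof.
  exists (Cmod c), 1; repeat split; try lra; try apply Cmod_ge_0.
  intros h _; simpl; lra.
Qed.

Lemma bigO_pow (n : nat) : bigO n (fun h => (h ^ n)%C).
Proof.
  exists 1, 1; repeat split; try lra.
  intros h _; rewrite Cmod_pow; lra.
Qed.

Lemma bigO_plus (n : nat) (f g : C -> C) :
  bigO n f -> bigO n g -> bigO n (fun h => (f h + g h)%C).
Proof.
  intros (K & d & HK & Hd & H) (K' & d' & HK' & Hd' & H').
  exists (K + K'), (Rmin d d'); repeat split; try lra.
  - now apply Rmin_glb_lt.
  - intros h Hh.
    eapply Rle_trans; [apply Cmod_triangle|].
    specialize (H h (Rlt_le_trans _ _ _ Hh (Rmin_l _ _))).
    specialize (H' h (Rlt_le_trans _ _ _ Hh (Rmin_r _ _))).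
    lra.
Qed.

Lemma bigO_mult (n m : nat) (f g : C -> C) :
  bigO n f -> bigO m g -> bigO (n + m) (fun h => (f h * g h)%C).
Proof.
  intros (K & d & HK & Hd & H) (K' & d' & HK' & Hd' & H').
  exists (K * K'), (Rmin d d'); repeat split.
  - now apply Rmult_le_pos.
  - now apply Rmin_glb_lt.
  - intros h Hh; rewrite Cmod_mult, pow_add.
    specialize (H h (Rlt_le_trans _ _ _ Hh (Rmin_l _ _))).
    specialize (H' h (Rlt_le_trans _ _ _ Hh (Rmin_r _ _))).
    replace (K * K' * (Cmod h ^ n * Cmod h ^ m))
      with ((K * Cmod h ^ n) * (K' * Cmod h ^ m)) by ring.
    apply Rmult_le_compat; auto using Cmod_ge_0.
Qed.

Lemma bigO_scal (n : nat) (c : C) (f : C -> C) :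
  bigO n f -> bigO n (fun h => (c * f h)%C).
Proof. exact (bigO_mult 0 n _ _ (bigO_const c)). Qed.

Lemma bigO_opp (n : nat) (f : C -> C) : bigO n f -> bigO n (fun h => (- f h)%C).
Proof.
  intros H; apply bigO_ext with (fun h => (- 1 * f h)%C).
  - intros h; ring.
  - now apply bigO_scal.
Qed.

Lemma bigO_minus (n : nat) (f g : C -> C) :
  bigO n f -> bigO n g -> bigO n (fun h => (f h - g h)%C).
Proof. intros Hf Hg; exact (bigO_plus n f _ Hf (bigO_opp n g Hg)). Qed.

Lemma bigO_weaken (n m : nat) (f : C -> C) : (m <= n)%nat -> bigO n f -> bigO m f.
Proof.
  intros L (K & d & HK & Hd & H).
  exists K, (Rmin d 1); repeat split; auto.
  - apply Rmin_glb_lt; lra.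
  - intros h Hh.
    eapply Rle_trans; [apply H, Rlt_le_trans with (1 := Hh), Rmin_l|].
    apply Rmult_le_compat_l; auto.
    replace n with (m + (n - m))%nat by lia.
    rewrite pow_add.
    assert (A : 0 <= Cmod h ^ m) by apply pow_le, Cmod_ge_0.
    assert (B : Cmod h <= 1)
      by (apply Rlt_le, Rlt_le_trans with (1 := Hh), Rmin_r).
    assert (D : Cmod h ^ (n - m) <= 1).
    { rewrite <- (pow1 (n - m)); apply pow_incr; split; auto using Cmod_ge_0. }
    nra.
Qed.

Lemma bigO_rotate (n : nat) (l : C) (f : C -> C) :
  Cmod l = 1 -> bigO n f -> bigO n (fun h => f (l * h)%C).
Proof.
  intros L (K & d & HK & Hd & H).
  exists K, d; repeat split; auto.
  intros h Hh.
  assert (E : Cmod (l * h) = Cmod h) by (rewrite Cmod_mult, L; ring).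
  rewrite <- E in Hh |- *; auto.
Qed.

(** For positive [k] the factorization says nothing about [g] at the origin, so the value there is
    supplied separately; elsewhere [Cmod h ^ k] is positive and cancels. *)
Lemma bigO_divide (n k : nat) (f g : C -> C) :
  (forall h, f h = h ^ k * g h)%C -> g (RtoC 0) = RtoC 0 ->
  bigO (k + n) f -> bigO n g.
Proof.
  intros E g0 (K & d & HK & Hd & H).
  exists K, d; repeat split; auto.
  intros h Hh.
  destruct (Ceq_dec h (RtoC 0)) as [->|h0].
  - rewrite g0, Cmod_0.
    apply Rmult_le_pos; auto; apply pow_le; lra.
  - specialize (H h Hh); rewrite E, Cmod_mult, Cmod_pow, pow_add in H.
    apply Rmult_le_reg_l with (Cmod h ^ k).
    + now apply pow_lt, Cmod_gt_0.
    + lra.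
Qed.

(** * Taylor remainders of power series *)

Lemma norm_Cmod (z : C) : @norm C_AbsRing C_NormedModule z = Cmod z.
Proof. reflexivity. Qed.

Lemma is_series_norm_le (a : nat -> C) (l : C) (B : R) :
  is_series a l -> (forall N, Cmod (sum_n a N) <= B) -> Cmod l <= B.
Proof.
  intros H HB.
  assert (L : is_lim_seq (fun N => Cmod (sum_n a N)) (Cmod l)).
  { exact (filterlim_comp _ _ _ _ _ _ _ _ H (filterlim_norm (l : C_NormedModule))). }
  apply (is_lim_seq_le _ _ (Cmod l) B HB L (is_lim_seq_const B)).
Qed.

Lemma pow_n_Cpow (z : C) (k : nat) : pow_n z k = (z ^ k)%C.
Proof. induction k as [|k IH]; [reflexivity|]; simpl; now rewrite IH. Qed.

(** Partial sums of a convergent series are bounded, and each term is the difference of two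
    consecutive ones. *)
Lemma pseries_coef_bound (c : nat -> C) (x l : C) :
  is_pseries c x l -> exists M, forall k, Cmod (x ^ k * c k)%C <= M.
Proof.
  intros H.
  destruct (filterlim_bounded (sum_n (fun k => scal (pow_n x k) (c k))))
    as [M HM]; [now exists l|].
  assert (M0 : 0 <= M) by exact (Rle_trans _ _ _ (norm_ge_0 _) (HM O)).
  exists (M + M); intros k.
  rewrite <- pow_n_Cpow.
  destruct k as [|k].
  - specialize (HM O); rewrite sum_O in HM.
    rewrite norm_Cmod in HM; change (Cmod (pow_n x 0 * c O) <= M) in HM; lra.
  - assert (E : (pow_n x (S k) * c (S k))%C =
      minus (sum_n (fun k => scal (pow_n x k) (c k)) (S k))
            (sum_n (fun k => scal (pow_n x k) (c k)) k)).
    { rewrite sum_Sn.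
      change ((pow_n x (S k) * c (S k))%C =
        (sum_n (fun k0 : nat => scal (pow_n x k0) (c k0)) k
         + pow_n x (S k) * c (S k)
         - sum_n (fun k0 : nat => scal (pow_n x k0) (c k0)) k)%C).
      ring. }
    rewrite E, <- norm_Cmod.
    unfold minus; eapply Rle_trans; [apply (norm_triangle (V := C_NormedModule))|].
    rewrite (norm_opp (V := C_NormedModule)); apply Rplus_le_compat; apply HM.
Qed.

Lemma sum_half_le (N : nat) : sum_n (fun k => (1 / 2) ^ k) N <= 2.
Proof.
  assert (E : sum_n (fun k => (1 / 2) ^ k) N = 2 - (1 / 2) ^ N).
  { induction N as [|N IH].
    - rewrite sum_O; simpl; lra.
    - rewrite sum_Sn, IH; unfold plus; simpl; lra. }
  rewrite E; assert (0 < (1 / 2) ^ N) by (apply pow_lt; lra); lra.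
Qed.

(** Convergence at the point [d / 2] bounds the terms there by some [M]. At a smaller [h] they gain
    the factor [(Cmod h / (d / 2)) ^ k], so a geometric series dominates the tail. *)
Lemma pseries_remainder (c : nat -> C) (f : C -> C) (d : R) (n : nat) :
  0 < d -> (forall h, Cmod h < d -> is_pseries c h (f h)) ->
  bigO (S n) (fun h => (f h - sum_n (fun k => (c k * h ^ k)%C) n)%C).
Proof.
  intros Hd H.
  assert (Er : Cmod (RtoC (d / 2)) = d / 2)
    by (rewrite Cmod_R, Rabs_pos_eq; lra).
  destruct (pseries_coef_bound c (RtoC (d / 2)) _ (H (RtoC (d / 2)) ltac:(lra)))
    as [M HM].
  assert (M0 : 0 <= M) by exact (Rle_trans _ _ _ (Cmod_ge_0 _) (HM O)).
  assert (P : 0 < (d / 2) ^ S n) by (apply pow_lt; lra).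
  (* Below [d / 4] the ratio [Cmod h / (d / 2)] is at most 1/2; the factor 2 is the sum of the
     geometric series. *)
  exists (2 * M / (d / 2) ^ S n), (d / 4); repeat split; try lra.
  { apply Rmult_le_pos; [lra|]; apply Rlt_le, Rinv_0_lt_compat, P. }
  intros h Hh.
  set (b := fun k => scal (pow_n h k) (c k)).
  assert (Eb : forall k, b k = (c k * h ^ k)%C).
  { intros k; unfold b; rewrite pow_n_Cpow.
    change ((h ^ k * c k)%C = (c k * h ^ k)%C); ring. }
  assert (S1 : is_series (fun k => b (S n + k)%nat)
                 (f h - sum_n (fun k => (c k * h ^ k)%C) n)%C).
  { apply is_series_incr_n; [lia|].
    rewrite (sum_n_ext _ b) by (intros; now rewrite Eb).
    refine (eq_ind (f h) (is_series b) (H h ltac:(lra)) _ _).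
    change (f h = (f h - sum_n b n + sum_n b n)%C); ring. }
  apply (is_series_norm_le _ _ _ S1); intros N.
  rewrite <- norm_Cmod; unfold sum_n.
  eapply Rle_trans; [apply (norm_sum_n_m (V := C_NormedModule))|].
  set (q := M * (Cmod h / (d / 2)) ^ S n).
  assert (Hq : 0 <= Cmod h / (d / 2)).
  { apply Rmult_le_pos; [apply Cmod_ge_0|]; apply Rlt_le, Rinv_0_lt_compat; lra. }
  assert (q0 : 0 <= q) by (apply Rmult_le_pos; auto using pow_le).
  apply Rle_trans with (sum_n (fun k => q * (1 / 2) ^ k) N).
  - apply sum_n_m_le; intros k.
    rewrite norm_Cmod, Eb.
    assert (E1 : (c (S n + k)%nat * h ^ (S n + k))%C =
      (RtoC (d / 2) ^ (S n + k) * c (S n + k)%nat * (h / RtoC (d / 2)) ^ (S n + k))%C).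
    { unfold Cdiv; rewrite Cpow_mult_l, Cpow_inv.
      - field; apply Cpow_nz; intros Z; apply RtoC_inj in Z; lra.
      - intros Z; apply RtoC_inj in Z; lra. }
    rewrite E1, Cmod_mult, (Cmod_pow (h / _)), Cmod_div, Er, pow_add.
    2: intros Z; apply RtoC_inj in Z; lra.
    unfold q; rewrite Rmult_assoc.
    apply Rmult_le_compat; auto using Cmod_ge_0, Rmult_le_pos, pow_le.
    apply Rmult_le_compat_l; [now apply pow_le|].
    apply pow_incr; split; auto.
    apply Rmult_le_reg_r with (d / 2); [lra|].
    unfold Rdiv at 1; rewrite Rmult_assoc, Rinv_l; lra.
  - eapply Rle_trans;
      [exact (Req_le _ _ (sum_n_mult_l (K := R_AbsRing) q (fun k => (1 / 2) ^ k) N))|].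
    apply Rle_trans with (q * 2).
    + apply Rmult_le_compat_l; auto; apply sum_half_le.
    + unfold q, Rdiv at 1; rewrite Rpow_mult_distr, pow_inv.
      apply Req_le; field; apply pow_nonzero; lra.
Qed.

(** * Maximum principle *)

(** Compactness in Lebesgue-number form: every point of the disc lies in an admissible ball, and the
    radii of the balls used have a common positive lower bound. It is deduced from compactness of
    the square circumscribed about the disc. *)
Lemma closed_disc_compact (r : R) (P : C -> R -> Prop) :
  (forall z, Cmod z <= r -> exists e, 0 < e /\ P z e) ->
  exists d, 0 < d /\ forall w, Cmod w <= r ->
    exists z e, Cmod z <= r /\ P z e /\ Cmod (w - z) < e /\ d <= e.
Proof.
  intros HP.
  (* A centre outside the disc gets a ball too small to reach the disc. The factor 2 absorbs the
     [sqrt 2] between the maximum norm on the square and the modulus. *)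
  assert (G : forall z : C, exists e : posreal,
    (Cmod z <= r -> P z (2 * e)) /\ (r < Cmod z -> 2 * e <= Cmod z - r)).
  { intros z; destruct (Rle_lt_dec (Cmod z) r) as [L|L].
    - destruct (HP z L) as (e & He & H).
      assert (He2 : 0 < e / 2) by lra.
      exists (mkposreal _ He2); simpl; split; [|lra].
      intros _; replace (2 * (e / 2)) with e by field; exact H.
    - assert (He2 : 0 < (Cmod z - r) / 2) by lra.
      exists (mkposreal _ He2); simpl; split; lra. }
  set (delta := fun u v : R => proj1_sig (constructive_indefinite_description _ (G (u, v)))).
  assert (Hdelta : forall u v,
    (Cmod (u, v) <= r -> P (u, v) (2 * delta u v)) /\
    (r < Cmod (u, v) -> 2 * delta u v <= Cmod (u, v) - r)).
  { intros u v; exact (proj2_sig (constructive_indefinite_description _ (G (u, v)))). }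
  destruct (compactness_value_2d (- r) r (- r) r delta) as [d Hd].
  exists d; split; [apply cond_pos|].
  intros [x y] Hw.
  pose proof (Rmax_Cmod (x, y)) as Hm; simpl in Hm.
  assert (Hx : Rabs x <= r).
  { apply Rle_trans with (2 := Hw), Rle_trans with (2 := Hm), Rmax_l. }
  assert (Hy : Rabs y <= r).
  { apply Rle_trans with (2 := Hw), Rle_trans with (2 := Hm), Rmax_r. }
  apply Rabs_le_between in Hx; apply Rabs_le_between in Hy.
  destruct (NNPP _ (Hd x y Hx Hy)) as (u & v & _ & _ & Hu & Hv & Hduv).
  assert (HC : Cmod ((x, y) - (u, v)) < 2 * delta u v).
  { eapply Rle_lt_trans; [apply Cmod_2Rmax|]; simpl.
    assert (B : Rmax (Rabs (x + - u)) (Rabs (y + - v)) < delta u v)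
      by now apply Rmax_lub_lt.
    assert (B0 : 0 <= Rmax (Rabs (x + - u)) (Rabs (y + - v)))
      by (eapply Rle_trans; [apply Rabs_pos | apply Rmax_l]).
    assert (S : sqrt 2 <= 2).
    { rewrite <- (sqrt_square 2) at 2; [apply sqrt_le_1; lra | lra]. }
    nra. }
  destruct (Hdelta u v) as [H1 H2].
  exists (u, v), (2 * delta u v).
  assert (Huv : Cmod (u, v) <= r).
  { apply Rnot_lt_le; intros L; specialize (H2 L).
    pose proof (Cmod_triangle (x, y) (- ((x, y) - (u, v)))%C) as T.
    rewrite Cmod_opp in T.
    assert (E : forall a b : C, (a + - (a - b))%C = b) by (intros; ring).
    rewrite E in T.
    lra. }
  pose proof (cond_pos d).
  repeat split; auto; lra.
Qed.

(** An upper semicontinuous function attains its maximum on a compact disc. Compactness serves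
    twice: to bound [u] above, then to exclude a supremum that is not attained. *)
Lemma closed_disc_max (r : R) (u : C -> R) :
  0 <= r ->
  (forall z eta, Cmod z <= r -> 0 < eta -> exists e, 0 < e /\
     forall w, Cmod (w - z) < e -> u w <= u z + eta) ->
  exists z, Cmod z <= r /\ forall w, Cmod w <= r -> u w <= u z.
Proof.
  intros Hr usc.
  (* Asking that [u z + 1 <= / e] turns the lower bound [d] on the radii into the upper bound [/ d]
     on [u]. *)
  destruct (closed_disc_compact r (fun z e =>
    (forall w, Cmod (w - z) < e -> u w <= u z + 1) /\ u z + 1 <= / e))
    as (d & Hd & Hbound).
  { intros z Hz; destruct (usc z 1 Hz Rlt_0_1) as (e & He & H).
    pose proof (Rabs_pos (u z)).
    assert (I : 0 < / (Rabs (u z) + 1)) by (apply Rinv_0_lt_compat; lra).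
    exists (Rmin e (/ (Rabs (u z) + 1))); split; [now apply Rmin_glb_lt|split].
    - intros w Hw; apply H, Rlt_le_trans with (1 := Hw), Rmin_l.
    - apply Rle_trans with (Rabs (u z) + 1).
      + pose proof (Rle_abs (u z)); lra.
      + rewrite <- (Rinv_inv (Rabs (u z) + 1)) at 1.
        apply Rinv_le_contravar; [now apply Rmin_glb_lt | apply Rmin_r]. }
  destruct (completeness (fun y => exists w, Cmod w <= r /\ y = u w)) as [M [HM1 HM2]].
  { exists (/ d); intros y (w & Hw & ->).
    destruct (Hbound w Hw) as (z & e & _ & [H1 H2] & Hwz & Hde).
    apply Rle_trans with (/ e); [specialize (H1 w Hwz); lra|].
    now apply Rinv_le_contravar. }
  { exists (u (RtoC 0)), (RtoC 0); split; [now rewrite Cmod_0 | reflexivity]. }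
  apply NNPP; intros N.
  assert (Hlt : forall z, Cmod z <= r -> u z < M).
  { intros z Hz; apply Rnot_le_lt; intros L; apply N; exists z; split; auto.
    intros w Hw; apply Rle_trans with (2 := L), HM1; now exists w. }
  (* If [u] stays below its supremum [M], each centre leaves half of its gap to [M] on its ball.
     Keeping [e] below that half gap makes [M - d'] a smaller upper bound. *)
  destruct (closed_disc_compact r (fun z e =>
    (forall w, Cmod (w - z) < e -> u w <= u z + (M - u z) / 2) /\ e <= (M - u z) / 2))
    as (d' & Hd' & Hgap).
  { intros z Hz; specialize (Hlt z Hz).
    destruct (usc z ((M - u z) / 2) Hz ltac:(lra)) as (e & He & H).
    exists (Rmin e ((M - u z) / 2)); split; [apply Rmin_glb_lt; lra|split].
    - intros w Hw; apply H, Rlt_le_trans with (1 := Hw), Rmin_l.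
    - apply Rmin_r. }
  assert (M <= M - d'); [|lra].
  apply HM2; intros y (w & Hw & ->).
  destruct (Hgap w Hw) as (z & e & _ & [H1 H2] & Hwz & Hde).
  specialize (H1 w Hwz); lra.
Qed.

Definition expands2 (f : C -> C) (z0 : C) : Prop :=
  exists q0 q1 q2 : C,
    bigO 3 (fun h => (f (z0 + h)%C - (q0 + q1 * h + q2 * h ^ 2))%C).

(** The neighbourhood in [bigO] is not punctured, so the estimate can be evaluated at [h = 0]. *)
Lemma bigO_at_0 (n : nat) (f : C -> C) : bigO (S n) f -> f (RtoC 0) = RtoC 0.
Proof.
  intros (K & d & HK & Hd & H).
  apply Cmod_eq_0, Rle_antisym; [|apply Cmod_ge_0].
  specialize (H (RtoC 0)); rewrite Cmod_0 in H; specialize (H Hd).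
  rewrite pow_i in H by lia; lra.
Qed.

Lemma expansion_value (f : C -> C) (z0 q0 q1 q2 : C) :
  bigO 3 (fun h => (f (z0 + h)%C - (q0 + q1 * h + q2 * h ^ 2))%C) -> f z0 = q0.
Proof.
  intros H; pose proof (bigO_at_0 _ _ H) as E; cbv beta in E.
  rewrite Cplus_0_r in E.
  replace q0 with (f z0 - (f z0 - (q0 + q1 * 0 + q2 * 0 ^ 2)))%C by ring.
  rewrite E; ring.
Qed.

Lemma expands2_continuous (f : C -> C) (z0 : C) :
  expands2 f z0 -> bigO 1 (fun h => (f (z0 + h)%C - f z0)%C).
Proof.
  intros (q0 & q1 & q2 & H).
  pose proof (expansion_value _ _ _ _ _ H) as E0.
  apply bigO_ext with (fun h =>
    ((f (z0 + h)%C - (q0 + q1 * h + q2 * h ^ 2)) + (q1 * h ^ 1 + q2 * h ^ 2))%C).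
  { intros h; rewrite E0; ring. }
  apply bigO_plus; [|apply bigO_plus].
  - apply bigO_weaken with 3%nat; [lia | exact H].
  - apply bigO_scal, bigO_pow.
  - apply bigO_scal, bigO_weaken with 2%nat; [lia | apply bigO_pow].
Qed.

Lemma Cmod2_plus_ge (p e : C) : Cmod (p + e) ^ 2 >= Cmod p ^ 2 - 2 * Cmod p * Cmod e.
Proof.
  pose proof (Cmod_triangle (p + e) (- e)) as T.
  replace (p + e + - e)%C with p in T by ring; rewrite Cmod_opp in T.
  pose proof (Cmod_ge_0 p); pose proof (Cmod_ge_0 e); pose proof (Cmod_ge_0 (p + e)).
  (* If [e] dominates, the right side is nonpositive; otherwise the reverse triangle inequality has
     nonnegative sides and can be squared. *)
  destruct (Rle_lt_dec (Cmod p) (Cmod e)); nra.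
Qed.

(** Parseval on the fourth roots of unity: the exponents 0, 1, 2 are distinct modulo 4, so all cross
    terms cancel in the sum. *)
Lemma four_point_mean (q0 q1 q2 : C) (s : R) :
  let p h := (q0 + q1 * h + q2 * h ^ 2)%C in
  Cmod (p s) ^ 2 + Cmod (p (- s)%C) ^ 2 + Cmod (p (Ci * s)%C) ^ 2
    + Cmod (p (- (Ci * s))%C) ^ 2
  = 4 * (Cmod q0 ^ 2 + Cmod q1 ^ 2 * s ^ 2 + Cmod q2 ^ 2 * s ^ 4).
Proof.
  intros p; unfold p; rewrite !Cmod2_alt.
  destruct q0, q1, q2; simpl; ring.
Qed.

(* The quadratic term of the expansion has mean zero over the four points
   [z0 + s i^j], so the mean of [|f|^2] exceeds [|f z0|^2] up to [O(s^3)],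
   whereas that of [|z|^2] exceeds [|z0|^2] by exactly [s^2]. *)
Lemma strictly_subharmonic (f : C -> C) (z0 : C) (eps d : R) :
  expands2 f z0 -> 0 < eps -> 0 < d ->
  exists h, Cmod h < d /\
    Cmod (f z0) ^ 2 + eps * Cmod z0 ^ 2
    < Cmod (f (z0 + h)%C) ^ 2 + eps * Cmod (z0 + h) ^ 2.
Proof.
  intros (q0 & q1 & q2 & H) Heps Hd.
  pose proof (expansion_value _ _ _ _ _ H) as E0.
  destruct H as (K & d' & HK & Hd' & H).
  set (A := Cmod q0 + Cmod q1 + Cmod q2).
  assert (HA : 0 <= A) by (unfold A; pose proof (Cmod_ge_0 q0);
    pose proof (Cmod_ge_0 q1); pose proof (Cmod_ge_0 q2); lra).
  assert (HAK : 0 <= A * K) by now apply Rmult_le_pos.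
  assert (HB : 0 < eps / (2 * (A * K) + 1)) by (apply Rdiv_lt_0_compat; lra).
  (* The last bound makes the remainder's contribution [2 * A * K * s ^ 3] smaller than the gain
     [eps * s ^ 2]; the bound 1 gives [Cmod p <= A] on the circle. *)
  set (m := Rmin (Rmin d d') (Rmin 1 (eps / (2 * (A * K) + 1)))).
  assert (Hm : 0 < m) by (unfold m; repeat apply Rmin_glb_lt; lra).
  set (s := m / 2).
  assert (Hs : 0 < s) by (unfold s; lra).
  assert (Hsd : s < d).
  { apply Rlt_le_trans with m; [unfold s; lra|].
    eapply Rle_trans; [apply Rmin_l | apply Rmin_l]. }
  assert (Hsd' : s < d').
  { apply Rlt_le_trans with m; [unfold s; lra|].
    eapply Rle_trans; [apply Rmin_l | apply Rmin_r]. }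
  assert (Hs1 : s < 1).
  { apply Rlt_le_trans with m; [unfold s; lra|].
    eapply Rle_trans; [apply Rmin_r | apply Rmin_l]. }
  assert (HsB : s * (2 * (A * K) + 1) < eps).
  { apply Rmult_lt_reg_r with (/ (2 * (A * K) + 1)); [apply Rinv_0_lt_compat; lra|].
    rewrite Rmult_assoc, Rinv_r, Rmult_1_r by lra.
    apply Rlt_le_trans with m; [unfold s; lra|].
    eapply Rle_trans; [apply Rmin_r | apply Rmin_r]. }
  apply NNPP; intros N.
  assert (Hle : forall h, Cmod h = s ->
    Cmod (q0 + q1 * h + q2 * h ^ 2)%C ^ 2 - 2 * A * (K * s ^ 3)
      + eps * Cmod (z0 + h) ^ 2 <= Cmod q0 ^ 2 + eps * Cmod z0 ^ 2).
  { intros h Hh.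
    apply Rle_trans with (Cmod (f (z0 + h)%C) ^ 2 + eps * Cmod (z0 + h) ^ 2).
    - apply Rplus_le_compat_r.
      set (p := (q0 + q1 * h + q2 * h ^ 2)%C).
      replace (f (z0 + h)%C) with (p + (f (z0 + h)%C - p))%C by ring.
      pose proof (Cmod2_plus_ge p (f (z0 + h)%C - p)) as G.
      specialize (H h ltac:(lra)); fold p in H; rewrite Hh in H.
      assert (Hp : Cmod p <= A).
      { unfold p, A; eapply Rle_trans; [apply Cmod_triangle|].
        apply Rplus_le_compat; [eapply Rle_trans; [apply Cmod_triangle|]|];
          [apply Rplus_le_compat_l|]; rewrite Cmod_mult, ?Cmod_pow, Hh.
        - pose proof (Cmod_ge_0 q1); nra.
        - pose proof (Cmod_ge_0 q2); assert (s ^ 2 <= 1) by nra; nra. }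
      assert (Cmod p * Cmod (f (z0 + h)%C - p) <= A * (K * s ^ 3))
        by (apply Rmult_le_compat; auto using Cmod_ge_0).
      lra.
    - rewrite <- E0; apply Rnot_lt_le; intros L; apply N; exists h.
      split; [lra | exact L]. }
  assert (Ms : Cmod (RtoC s) = s) by (rewrite Cmod_R; apply Rabs_pos_eq; lra).
  assert (Mis : Cmod (Ci * s) = s) by (rewrite Cmod_mult, Cmod_Ci, Ms; ring).
  pose proof (Hle _ Ms) as L1.
  pose proof (Hle (- s)%C ltac:(now rewrite Cmod_opp)) as L2.
  pose proof (Hle _ Mis) as L3.
  pose proof (Hle (- (Ci * s))%C ltac:(now rewrite Cmod_opp)) as L4.
  pose proof (four_point_mean q0 q1 q2 s) as F1; cbv zeta beta in F1.
  (* The same identity for the polynomial [z0 + h] gives the mean of [Cmod (z0 + h) ^ 2]. *)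
  pose proof (four_point_mean z0 1 0 s) as F2; cbv zeta beta in F2.
  rewrite Cmod_1, Cmod_0 in F2.
  assert (Z : forall h, (z0 + 1 * h + 0 * h ^ 2)%C = (z0 + h)%C) by (intros; ring).
  rewrite !Z in F2.
  assert (0 <= Cmod q1 ^ 2 * s ^ 2) by (apply Rmult_le_pos; apply pow2_ge_0).
  assert (0 <= Cmod q2 ^ 2 * s ^ 4)
    by (apply Rmult_le_pos; [apply pow2_ge_0 | apply pow_le; lra]).
  assert (T : 4 * (eps * s ^ 2) <= 4 * (2 * A * (K * s ^ 3))).
  { apply (f_equal (Rmult eps)) in F2; lra. }
  assert (0 < s ^ 2) by (apply pow_lt; lra).
  assert (T2 : s ^ 2 * (eps - s * (2 * (A * K))) <= 0).
  { replace (s ^ 2 * (eps - s * (2 * (A * K))))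
      with (eps * s ^ 2 - 2 * A * (K * s ^ 3)) by ring; lra. }
  nra.
Qed.

(** Adding [eps * Cmod z ^ 2] to [Cmod (f z) ^ 2] makes it strictly subharmonic, so its maximum over
    the closed disc lies on the boundary circle. Then [eps] tends to 0. *)
Lemma maximum_principle (f : C -> C) (r B : R) :
  0 < r -> 0 <= B ->
  (forall z, Cmod z <= r -> expands2 f z) ->
  (forall z, Cmod z = r -> Cmod (f z) <= B) ->
  Cmod (f (RtoC 0)) <= B.
Proof.
  intros Hr HB Hf Hbd.
  assert (Heps : forall eps, 0 < eps ->
    Cmod (f (RtoC 0)) ^ 2 <= B ^ 2 + eps * r ^ 2).
  { intros eps Heps.
    destruct (closed_disc_max r (fun z => Cmod (f z) ^ 2 + eps * Cmod z ^ 2))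
      as (z0 & Hz0 & Hmax); [lra| |].
    - intros z eta Hz Heta.
      destruct (expands2_continuous f z (Hf z Hz)) as (K & d & HK & Hd & H).
      pose proof (Cmod_ge_0 (f z)) as F0; pose proof (Cmod_ge_0 z) as Z0.
      (* For [s < 1], moving by [s] raises the perturbed square by at most [D * s]: expand
         [(Cmod (f z) + K * s) ^ 2] and [(Cmod z + s) ^ 2] and use [s ^ 2 <= s]. *)
      set (D := K * (2 * Cmod (f z) + K) + eps * (2 * Cmod z + 1)).
      assert (HD : 0 <= D) by (unfold D; apply Rplus_le_le_0_compat;
        apply Rmult_le_pos; lra).
      assert (HeD : 0 < eta / (D + 1)) by (apply Rdiv_lt_0_compat; lra).
      exists (Rmin d (Rmin 1 (eta / (D + 1)))); split;
        [repeat apply Rmin_glb_lt; lra|].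
      intros w Hw.
      set (s := Cmod (w - z)) in *.
      assert (s0 : 0 <= s) by apply Cmod_ge_0.
      assert (s1 : s < d) by (eapply Rlt_le_trans; [exact Hw | apply Rmin_l]).
      assert (Hw' : s < Rmin 1 (eta / (D + 1)))
        by (eapply Rlt_le_trans; [exact Hw | apply Rmin_r]).
      assert (s2 : s < 1) by (eapply Rlt_le_trans; [exact Hw' | apply Rmin_l]).
      assert (s3 : s < eta / (D + 1))
        by (eapply Rlt_le_trans; [exact Hw' | apply Rmin_r]).
      assert (s4 : s * (D + 1) <= eta).
      { apply Rmult_le_reg_r with (/ (D + 1)); [apply Rinv_0_lt_compat; lra|].
        rewrite Rmult_assoc, Rinv_r, Rmult_1_r by lra; unfold Rdiv in s3; lra. }
      specialize (H (w - z)%C s1); rewrite pow_1 in H; fold s in H.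
      replace (z + (w - z))%C with w in H by ring.
      assert (A1 : Cmod (f w) <= Cmod (f z) + K * s).
      { replace (f w) with (f z + (f w - f z))%C by ring.
        eapply Rle_trans; [apply Cmod_triangle | lra]. }
      assert (A2 : Cmod w <= Cmod z + s).
      { replace w with (z + (w - z))%C by ring; apply Cmod_triangle. }
      assert (A3 : Cmod (f w) ^ 2 <= (Cmod (f z) + K * s) ^ 2)
        by (apply pow_incr; split; [apply Cmod_ge_0 | exact A1]).
      assert (A4 : Cmod w ^ 2 <= (Cmod z + s) ^ 2)
        by (apply pow_incr; split; [apply Cmod_ge_0 | exact A2]).
      assert (A5 : s ^ 2 <= s) by nra.
      assert (A6 : K ^ 2 * s ^ 2 <= K ^ 2 * s)
        by (apply Rmult_le_compat_l; [apply pow2_ge_0 | exact A5]).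
      assert (A7 : eps * Cmod w ^ 2 <= eps * (Cmod z ^ 2 + 2 * Cmod z * s + s))
        by (apply Rmult_le_compat_l; lra).
      unfold D in s4; lra.
    - destruct (Rle_lt_or_eq_dec _ _ Hz0) as [L|L].
      + destruct (strictly_subharmonic f z0 eps (r - Cmod z0) (Hf z0 Hz0) Heps
          ltac:(lra)) as (h & Hh & Hlt).
        pose proof (Cmod_triangle z0 h).
        specialize (Hmax (z0 + h)%C ltac:(lra)); simpl in *; lra.
      + specialize (Hmax (RtoC 0)); rewrite Cmod_0 in Hmax.
        specialize (Hmax ltac:(lra)); rewrite L in Hmax.
        assert (Cmod (f z0) ^ 2 <= B ^ 2)
          by (apply pow_incr; split; [apply Cmod_ge_0 | auto]).
        lra. }
  apply Rnot_lt_le; intros L.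
  assert (P : 0 < Cmod (f (RtoC 0)) ^ 2 - B ^ 2) by nra.
  assert (r2 : 0 < r ^ 2) by (apply pow_lt; lra).
  set (P0 := Cmod (f (RtoC 0)) ^ 2 - B ^ 2) in *.
  (* This [eps] contributes only half of the supposed excess [P0]. *)
  assert (I : 0 < P0 / (2 * r ^ 2)) by (apply Rdiv_lt_0_compat; lra).
  specialize (Heps _ I).
  replace (P0 / (2 * r ^ 2) * r ^ 2) with (P0 / 2) in Heps by (field; lra).
  unfold P0 in *; lra.
Qed.

(** * Stability of second-order expansions *)

Lemma bigO_ext_near (n : nat) (f g : C -> C) (d : R) :
  0 < d -> (forall h, Cmod h < d -> f h = g h) -> bigO n f -> bigO n g.
Proof.
  intros Hd E (K & d' & HK & Hd' & H); exists K, (Rmin d d'); repeat split; auto.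
  - now apply Rmin_glb_lt.
  - intros h Hh; rewrite <- E.
    + apply H, Rlt_le_trans with (1 := Hh), Rmin_r.
    + apply Rlt_le_trans with (1 := Hh), Rmin_l.
Qed.

Lemma bigO_id : bigO 0 (fun h => h).
Proof.
  apply (bigO_weaken 1 0); [lia|].
  apply bigO_ext with (fun h => (h ^ 1)%C); [intros h; ring | apply bigO_pow].
Qed.

Ltac bigO_bounded :=
  repeat first
    [ apply bigO_const
    | apply bigO_id
    | apply (bigO_weaken _ 0 _ (Nat.le_0_l _) (bigO_pow _))
    | apply (bigO_plus 0)
    | apply (bigO_mult 0 0) ].

(** At a small positive real [s], cancelling [s ^ n] leaves [Cmod c <= K * s], which fails for
    [s < Cmod c / (K + 1)] unless [c] is zero. *)
Lemma bigO_monomial (n : nat) (c : C) :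
  bigO (S n) (fun h => (c * h ^ n)%C) -> c = RtoC 0.
Proof.
  intros (K & d & HK & Hd & H).
  apply Cmod_eq_0, Rle_antisym; [|apply Cmod_ge_0].
  apply Rnot_lt_le; intros L.
  assert (I : 0 < Cmod c / (K + 1)) by (apply Rdiv_lt_0_compat; lra).
  set (s := Rmin d (Cmod c / (K + 1)) / 2).
  assert (Hm : 0 < Rmin d (Cmod c / (K + 1))) by now apply Rmin_glb_lt.
  assert (s0 : 0 < s) by (unfold s; lra).
  assert (s1 : s < d) by (pose proof (Rmin_l d (Cmod c / (K + 1))); unfold s; lra).
  assert (s2 : s < Cmod c / (K + 1))
    by (pose proof (Rmin_r d (Cmod c / (K + 1))); unfold s; lra).
  assert (Ms : Cmod (RtoC s) = s) by (rewrite Cmod_R; apply Rabs_pos_eq; lra).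
  specialize (H (RtoC s)); rewrite Cmod_mult, Cmod_pow, Ms in H; specialize (H s1).
  assert (P : 0 < s ^ n) by now apply pow_lt.
  simpl in H.
  assert (Cmod c <= K * s).
  { apply Rmult_le_reg_r with (1 := P); lra. }
  assert (s * (K + 1) < Cmod c).
  { apply Rmult_lt_reg_r with (/ (K + 1)); [apply Rinv_0_lt_compat; lra|].
    rewrite Rmult_assoc, Rinv_r, Rmult_1_r by lra; exact s2. }
  lra.
Qed.

(** Used to identify coefficients one by one, starting with the lowest order. *)
Lemma bigO_leading_coef (n : nat) (c : C) (g : C -> C) :
  bigO (S n) (fun h => (c * h ^ n + h ^ S n * g h)%C) -> bigO 0 g -> c = RtoC 0.
Proof.
  intros H Hg; apply bigO_monomial with n.
  apply bigO_ext with (fun h =>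
    ((c * h ^ n + h ^ S n * g h) - h ^ S n * g h)%C); [intros h; ring|].
  apply bigO_minus; [exact H|].
  replace (S n) with (S n + 0)%nat at 1 by lia.
  now apply bigO_mult; [apply bigO_pow|].
Qed.

Lemma expands2_ext_near (f g : C -> C) (z0 : C) (d : R) :
  0 < d -> (forall h, Cmod h < d -> f (z0 + h)%C = g (z0 + h)%C) ->
  expands2 f z0 -> expands2 g z0.
Proof.
  intros Hd E (q0 & q1 & q2 & H); exists q0, q1, q2.
  revert H; apply bigO_ext_near with d; auto.
  intros h Hh; now rewrite E.
Qed.

Lemma expands2_const (c z0 : C) : expands2 (fun _ => c) z0.
Proof.
  exists c, (RtoC 0), (RtoC 0).
  apply bigO_ext with (fun h => (0 * h ^ 3)%C); [intros h; ring|].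
  apply bigO_scal, bigO_pow.
Qed.

Lemma expands2_plus (f g : C -> C) (z0 : C) :
  expands2 f z0 -> expands2 g z0 -> expands2 (fun z => (f z + g z)%C) z0.
Proof.
  intros (p0 & p1 & p2 & Hf) (q0 & q1 & q2 & Hg).
  exists (p0 + q0)%C, (p1 + q1)%C, (p2 + q2)%C.
  eapply bigO_ext; [|exact (bigO_plus _ _ _ Hf Hg)].
  intros h; cbv beta; ring.
Qed.

Lemma expands2_mult (f g : C -> C) (z0 : C) :
  expands2 f z0 -> expands2 g z0 -> expands2 (fun z => (f z * g z)%C) z0.
Proof.
  intros (p0 & p1 & p2 & Hf) (q0 & q1 & q2 & Hg).
  exists (p0 * q0)%C, (p0 * q1 + p1 * q0)%C, (p0 * q2 + p1 * q1 + p2 * q0)%C.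
  set (p := fun h : C => (p0 + p1 * h + p2 * h ^ 2)%C).
  set (q := fun h : C => (q0 + q1 * h + q2 * h ^ 2)%C).
  assert (Hp : bigO 0 p) by (unfold p; bigO_bounded).
  assert (Hq : bigO 0 q) by (unfold q; bigO_bounded).
  change (bigO 3 (fun h => (f (z0 + h)%C - p h)%C)) in Hf.
  change (bigO 3 (fun h => (g (z0 + h)%C - q h)%C)) in Hg.
  (* With [p] and [q] the quadratic parts, [f g = (f - p)(g - q) + (f - p) q + p (g - q) + p q].
     This factor times [h ^ 3] is what [p q] has beyond degree two. *)
  assert (Hr : bigO 0 (fun h => (p1 * q2 + p2 * q1 + p2 * q2 * h)%C)) by bigO_bounded.
  eapply bigO_ext; [|exact (bigO_plus 3 _ _ (bigO_plus 3 _ _ (bigO_plus 3 _ _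
     (bigO_weaken 6 3 _ ltac:(lia) (bigO_mult 3 3 _ _ Hf Hg))
     (bigO_mult 3 0 _ _ Hf Hq)) (bigO_mult 0 3 _ _ Hp Hg))
     (bigO_mult 3 0 _ _ (bigO_pow 3) Hr))].
  intros h; unfold p, q; cbv beta; ring.
Qed.

Lemma expands2_scal (c : C) (f : C -> C) (z0 : C) :
  expands2 f z0 -> expands2 (fun z => (c * f z)%C) z0.
Proof. intros H; exact (expands2_mult _ _ _ (expands2_const c z0) H). Qed.

Lemma expands2_minus (f g : C -> C) (z0 : C) :
  expands2 f z0 -> expands2 g z0 -> expands2 (fun z => (f z - g z)%C) z0.
Proof.
  intros Hf Hg.
  apply expands2_ext_near with (fun z => (f z + - 1 * g z)%C) 1; [lra| |].
  - intros h _; ring.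
  - apply expands2_plus; [exact Hf | now apply expands2_scal].
Qed.

Lemma expands2_pow (k : nat) (f : C -> C) (z0 : C) :
  expands2 f z0 -> expands2 (fun z => (f z ^ k)%C) z0.
Proof.
  intros Hf; induction k as [|k IH].
  - exact (expands2_const (RtoC 1) z0).
  - exact (expands2_mult _ _ _ Hf IH).
Qed.

Lemma expands2_rotate (l : C) (f : C -> C) (z0 : C) :
  Cmod l = 1 -> expands2 f (l * z0)%C -> expands2 (fun z => f (l * z)%C) z0.
Proof.
  intros Hl (q0 & q1 & q2 & H).
  exists q0, (q1 * l)%C, (q2 * l ^ 2)%C.
  eapply bigO_ext; [|exact (bigO_rotate _ l _ Hl H)].
  intros h; cbv beta.
  replace (l * (z0 + h))%C with (l * z0 + l * h)%C by ring; ring.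
Qed.

Lemma plus_small_nz (z0 h : C) : Cmod h < Cmod z0 -> (z0 + h)%C <> RtoC 0.
Proof.
  intros Hh E.
  assert (E' : z0 = (- h)%C).
  { replace z0 with ((z0 + h) - h)%C by ring; rewrite E; ring. }
  rewrite E', Cmod_opp in Hh; lra.
Qed.

Lemma expands2_inv (z0 : C) : z0 <> RtoC 0 -> expands2 Cinv z0.
Proof.
  intros nz.
  assert (P : 0 < Cmod z0) by now apply Cmod_gt_0.
  exists (/ z0)%C, (- / z0 ^ 2)%C, (/ z0 ^ 3)%C.
  (* The remainder of the geometric expansion is exactly [h ^ 3] times this function, which is
     bounded because [z0 + h] keeps modulus at least [Cmod z0 / 2]. *)
  assert (B : bigO 0 (fun h => (- / z0 ^ 3 * / (z0 + h))%C)).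
  { apply (bigO_mult 0 0); [apply bigO_const|].
    exists (/ (Cmod z0 / 2)), (Cmod z0 / 2); repeat split; try lra.
    - apply Rlt_le, Rinv_0_lt_compat; lra.
    - intros h Hh; rewrite Cmod_inv by (apply plus_small_nz; lra).
      simpl; rewrite Rmult_1_r; apply Rinv_le_contravar; [lra|].
      pose proof (Cmod_triangle (z0 + h) (- h)) as T; rewrite Cmod_opp in T.
      replace (z0 + h + - h)%C with z0 in T by ring; lra. }
  apply bigO_ext_near with (fun h => (h ^ 3 * (- / z0 ^ 3 * / (z0 + h)))%C) (Cmod z0).
  - exact P.
  - intros h Hh; field; split; [exact nz | now apply plus_small_nz].
  - exact (bigO_mult 3 0 _ _ (bigO_pow 3) B).
Qed.

Lemma analytic_expands2 (D : C -> Prop) (f : C -> C) (z0 : C) :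
  analytic_on D f -> D z0 -> expands2 f z0.
Proof.
  intros H Hz; destruct (H z0 Hz) as (c & d & Hd & Hc).
  exists (c 0%nat), (c 1%nat), (c 2%nat).
  eapply bigO_ext; [|apply (pseries_remainder c (fun h => f (z0 + h)%C) d 2 Hd)].
  - intros h; cbv beta.
    rewrite !sum_Sn, sum_O; unfold plus; simpl; ring.
  - intros h Hh.
    assert (E : (z0 + h - z0)%C = h) by ring.
    rewrite <- E at 1; apply Hc; now rewrite E.
Qed.

(** The quotient of [S z] by [z ^ k], with [c] filling the singularity at the origin. The power of
    an inverse is used so that [expands2_inv] and [expands2_pow] apply. *)
Definition quot_pow (k : nat) (c : C) (S : C -> C) (z : C) : C :=
  if Ceq_dec z (RtoC 0) then c else (S z * (/ z) ^ k)%C.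

Lemma quot_pow_mult (k : nat) (c : C) (S : C -> C) (z : C) :
  z <> RtoC 0 -> (quot_pow k c S z * z ^ k)%C = S z.
Proof.
  intros nz; unfold quot_pow; destruct (Ceq_dec z (RtoC 0)) as [E|_]; [easy|].
  rewrite <- Cmult_assoc, <- Cpow_mult_l, Cinv_l, Cpow_1_l by exact nz; ring.
Qed.

(** At the origin the quotient is [c] up to a cubic error, so its linear and quadratic coefficients
    vanish. The sections of a power series modulo 4 have this form, as the exponent after [k] is
    [k + 4]. *)
Lemma expands2_quot_pow (k : nat) (c : C) (S : C -> C) (z0 : C) :
  expands2 S z0 -> (0 < k)%nat ->
  bigO (k + 3) (fun h => (S h - c * h ^ k)%C) ->
  expands2 (quot_pow k c S) z0.
Proof.
  intros HS Hk H0; destruct (Ceq_dec z0 (RtoC 0)) as [->|nz].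
  - exists c, (RtoC 0), (RtoC 0).
    apply bigO_ext with (fun h => (quot_pow k c S h - c)%C).
    { intros h; rewrite Cplus_0_l; ring. }
    apply (fun E g0 => bigO_divide 3 k _ _ E g0 H0).
    + intros h; destruct (Ceq_dec h (RtoC 0)) as [->|hz].
      * replace k with (Datatypes.S (k - 1)) in H0 |- * by lia.
        pose proof (bigO_at_0 _ _ H0) as E; cbv beta in E.
        rewrite E; simpl; ring.
      * rewrite <- (quot_pow_mult k c S h hz); ring.
    + unfold quot_pow; destruct (Ceq_dec 0 0) as [_|N]; [ring | easy].
  - apply expands2_ext_near with (fun z => (S z * (/ z) ^ k)%C) (Cmod z0).
    + now apply Cmod_gt_0.
    + intros h Hh; unfold quot_pow.
      destruct (Ceq_dec (z0 + h) 0) as [E|_]; [|reflexivity].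
      now apply plus_small_nz in E.
    + apply expands2_mult; [exact HS|].
      exact (expands2_pow k _ _ (expands2_inv z0 nz)).
Qed.

(** * The Hankel determinant of a Schwarz function *)

(* [comp1], [comp2], [comp3] are four times the parts of the expansion of [w]
   with exponents congruent to 1, 2, 3 modulo 4. *)
Definition comp1 (w : C -> C) (z : C) : C :=
  (w (1 * z) - Ci * w (Ci * z) - w (- (1) * z) + Ci * w (- Ci * z))%C.
Definition comp2 (w : C -> C) (z : C) : C :=
  (w (1 * z) - w (Ci * z) + w (- (1) * z) - w (- Ci * z))%C.
Definition comp3 (w : C -> C) (z : C) : C :=
  (w (1 * z) + Ci * w (Ci * z) - w (- (1) * z) - Ci * w (- Ci * z))%C.

(** Together with the omitted section, the sum [x + y + u + v], the squares add up to four times the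
    sum of the four squared values of [w], hence to at most 16. *)
Lemma comp_parseval (w : C -> C) (z : C) :
  Cmod (w (1 * z)%C) <= 1 -> Cmod (w (Ci * z)%C) <= 1 ->
  Cmod (w (- (1) * z)%C) <= 1 -> Cmod (w (- Ci * z)%C) <= 1 ->
  Cmod (comp1 w z) ^ 2 + Cmod (comp2 w z) ^ 2 + Cmod (comp3 w z) ^ 2 <= 16.
Proof.
  unfold comp1, comp2, comp3.
  generalize (w (1 * z)%C) (w (Ci * z)%C) (w (- (1) * z)%C) (w (- Ci * z)%C).
  intros x y u v Hx Hy Hu Hv.
  assert (Sq : forall a, Cmod a <= 1 -> Cmod a ^ 2 <= 1).
  { intros a Ha; pose proof (Cmod_ge_0 a); nra. }
  apply Sq in Hx; apply Sq in Hy; apply Sq in Hu; apply Sq in Hv.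
  pose proof (pow2_ge_0 (Cmod (x + y + u + v))) as P.
  rewrite Cmod2_alt in *; rewrite !Cmod2_alt.
  destruct x, y, u, v; simpl in *; lra.
Qed.

Lemma Ci_sqr : (Ci * Ci)%C = (- (1))%C.
Proof. apply injective_projections; simpl; ring. Qed.

Section Schwarz.

Variables (w : C -> C) (c : nat -> C) (d : R).
Hypothesis w_an : analytic_on (Defs.disc 1) w.
Hypothesis w_le : forall z, Defs.disc 1 z -> Cmod (w z) <= 1.
Hypothesis d_pos : 0 < d.
Hypothesis w_series : forall h, Cmod h < d -> is_pseries c h (w h).

(** Five orders are kept because the third section is needed up to an error of order six. *)
Let rem (h : C) : C :=
  (w h - (c 0%nat + c 1%nat * h + c 2%nat * h ^ 2 + c 3%nat * h ^ 3
          + c 4%nat * h ^ 4 + c 5%nat * h ^ 5))%C.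

Lemma rem_bigO (n : nat) (l : C) :
  (n <= 6)%nat -> Cmod l = 1 -> bigO n (fun h => rem (l * h)%C).
Proof.
  intros Hn Hl; apply bigO_rotate; [exact Hl|].
  apply bigO_weaken with 6%nat; [exact Hn|].
  eapply bigO_ext; [|exact (pseries_remainder c w d 5 d_pos w_series)].
  intros h; unfold rem; rewrite !sum_Sn, sum_O; unfold plus; simpl; ring.
Qed.

Lemma Cmod_opp1 : Cmod (- (1)) = 1.
Proof. rewrite Cmod_opp; apply Cmod_1. Qed.

Lemma Cmod_oppCi : Cmod (- Ci) = 1.
Proof. rewrite Cmod_opp; apply Cmod_Ci. Qed.

(** Exponents not congruent to 1 modulo 4 cancel over the rotations. Among those up to 5 there
    remain 1 and 5, whence the extra term in [c 5]. *)
Lemma comp1_bigO : bigO 4 (fun h => (comp1 w h - 4 * c 1%nat * h ^ 1)%C).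
Proof.
  apply bigO_ext with (fun h => (rem (1 * h)%C - Ci * rem (Ci * h)%C
    - rem (- (1) * h)%C + Ci * rem (- Ci * h)%C + 4 * c 5%nat * h ^ 5)%C).
  (* The rewriting rule [I] lets [ring] reduce all powers of [Ci]. *)
  { intros h; unfold rem, comp1; pose proof Ci_sqr as I; ring [I]. }
  apply bigO_plus; [apply bigO_plus; [apply bigO_minus; [apply bigO_minus|]|]|].
  - apply rem_bigO; [lia | apply Cmod_1].
  - apply bigO_scal, rem_bigO; [lia | apply Cmod_Ci].
  - apply rem_bigO; [lia | apply Cmod_opp1].
  - apply bigO_scal, rem_bigO; [lia | apply Cmod_oppCi].
  - apply bigO_scal, bigO_weaken with 5%nat; [lia | apply bigO_pow].
Qed.

Lemma comp2_bigO : bigO 5 (fun h => (comp2 w h - 4 * c 2%nat * h ^ 2)%C).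
Proof.
  apply bigO_ext with (fun h => (rem (1 * h)%C - rem (Ci * h)%C
    + rem (- (1) * h)%C - rem (- Ci * h)%C)%C).
  { intros h; unfold rem, comp2; pose proof Ci_sqr as I; ring [I]. }
  apply bigO_minus; [apply bigO_plus; [apply bigO_minus|]|].
  - apply rem_bigO; [lia | apply Cmod_1].
  - apply rem_bigO; [lia | apply Cmod_Ci].
  - apply rem_bigO; [lia | apply Cmod_opp1].
  - apply rem_bigO; [lia | apply Cmod_oppCi].
Qed.

Lemma comp3_bigO : bigO 6 (fun h => (comp3 w h - 4 * c 3%nat * h ^ 3)%C).
Proof.
  apply bigO_ext with (fun h => (rem (1 * h)%C + Ci * rem (Ci * h)%C
    - rem (- (1) * h)%C - Ci * rem (- Ci * h)%C)%C).
  { intros h; unfold rem, comp3; pose proof Ci_sqr as I; ring [I]. }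
  apply bigO_minus; [apply bigO_minus; [apply bigO_plus|]|].
  - apply rem_bigO; [lia | apply Cmod_1].
  - apply bigO_scal, rem_bigO; [lia | apply Cmod_Ci].
  - apply rem_bigO; [lia | apply Cmod_opp1].
  - apply bigO_scal, rem_bigO; [lia | apply Cmod_oppCi].
Qed.

Lemma disc_rotate (l z : C) : Cmod l = 1 -> Defs.disc 1 z -> Defs.disc 1 (l * z).
Proof. unfold Defs.disc; intros Hl Hz; rewrite Cmod_mult, Hl; lra. Qed.

Lemma comp_expands2 (z : C) : Defs.disc 1 z ->
  expands2 (comp1 w) z /\ expands2 (comp2 w) z /\ expands2 (comp3 w) z.
Proof.
  intros Hz.
  assert (H : forall l, Cmod l = 1 -> expands2 (fun z => w (l * z)%C) z).
  { intros l Hl; apply expands2_rotate; [exact Hl|].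
    now apply (analytic_expands2 _ _ _ w_an), disc_rotate. }
  pose proof (H _ Cmod_1) as H1; pose proof (H _ Cmod_Ci) as H2.
  pose proof (H _ Cmod_opp1) as H3; pose proof (H _ Cmod_oppCi) as H4.
  unfold comp1, comp2, comp3.
  repeat split;
    repeat first [assumption | apply expands2_minus | apply expands2_plus
                 | apply expands2_scal].
Qed.

(** Isobaric of weight 4 when [x], [y], [u] have weights 1, 2, 3, so that a factor [z ^ 4] comes
    out. The 16 makes the factors 4 in the sections produce a common 256. *)
Let hankel (k : R) (x y u : C) : C := (16 * k * (x * u - y ^ 2) - x ^ 4)%C.

(** By the arithmetic-geometric inequality [Cmod x * Cmod u + Cmod y ^ 2] is at most the sum of the
    three squares, hence at most 16; and [Cmod x ^ 4 <= 16 ^ 2]. *)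
Lemma comp_hankel_le (k : R) (z : C) : 0 <= k -> Defs.disc 1 z ->
  Cmod (hankel k (comp1 w z) (comp2 w z) (comp3 w z)) <= 256 * (k + 1).
Proof.
  intros Hk Hz.
  assert (P : Cmod (comp1 w z) ^ 2 + Cmod (comp2 w z) ^ 2 + Cmod (comp3 w z) ^ 2 <= 16).
  { apply comp_parseval; apply w_le, disc_rotate; trivial;
      [apply Cmod_1 | apply Cmod_Ci | apply Cmod_opp1 | apply Cmod_oppCi]. }
  revert P; generalize (comp1 w z) (comp2 w z) (comp3 w z); intros x y u P.
  unfold hankel, Cminus at 1.
  eapply Rle_trans; [apply Cmod_triangle|]; rewrite Cmod_opp, Cmod_pow.
  rewrite !Cmod_mult, !Cmod_R, (Rabs_pos_eq 16), (Rabs_pos_eq k) by lra.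
  assert (A : Cmod (x * u - y ^ 2) <= 16).
  { unfold Cminus; eapply Rle_trans; [apply Cmod_triangle|].
    rewrite Cmod_opp, Cmod_pow, Cmod_mult.
    pose proof (pow2_ge_0 (Cmod x - Cmod u)).
    pose proof (pow2_ge_0 (Cmod x)); pose proof (pow2_ge_0 (Cmod u)); lra. }
  assert (B : Cmod x ^ 4 <= 256).
  { pose proof (pow2_ge_0 (Cmod y)); pose proof (pow2_ge_0 (Cmod u)).
    pose proof (pow2_ge_0 (Cmod x)).
    replace (Cmod x ^ 4) with (Cmod x ^ 2 * Cmod x ^ 2) by ring.
    replace 256 with (16 * 16) by ring.
    apply Rmult_le_compat; lra. }
  assert (k * Cmod (x * u - y ^ 2) <= k * 16) by now apply Rmult_le_compat_l.
  lra.
Qed.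

Lemma schwarz_hankel (k : R) : 0 <= k ->
  Cmod (k * (c 1%nat * c 3%nat - c 2%nat ^ 2) - c 1%nat ^ 4)%C <= k + 1.
Proof.
  intros Hk.
  set (q1 := quot_pow 1 (4 * c 1%nat) (comp1 w)).
  set (q2 := quot_pow 2 (4 * c 2%nat) (comp2 w)).
  set (q3 := quot_pow 3 (4 * c 3%nat) (comp3 w)).
  set (Q := fun z => hankel k (q1 z) (q2 z) (q3 z)).
  assert (HQ : forall z, Defs.disc 1 z -> expands2 Q z).
  { intros z Hz; destruct (comp_expands2 z Hz) as (E1 & E2 & E3).
    assert (F1 : expands2 q1 z)
      by (apply expands2_quot_pow; [exact E1 | lia | exact comp1_bigO]).
    assert (F2 : expands2 q2 z)
      by (apply expands2_quot_pow; [exact E2 | lia | exact comp2_bigO]).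
    assert (F3 : expands2 q3 z)
      by (apply expands2_quot_pow; [exact E3 | lia | exact comp3_bigO]).
    apply expands2_minus; [|now apply expands2_pow].
    apply expands2_scal, expands2_minus; [|now apply expands2_pow].
    now apply expands2_mult. }
  assert (Q0 : Q (RtoC 0)
    = (256 * (k * (c 1%nat * c 3%nat - c 2%nat ^ 2) - c 1%nat ^ 4))%C).
  { unfold Q, q1, q2, q3, quot_pow, hankel.
    destruct (Ceq_dec 0 0) as [_|N]; [ring | easy]. }
  (* On the circle of radius [r], [Q] is the bounded expression divided by [z ^ 4]; the loss [r ^ 4]
     disappears as [r] tends to 1. *)
  assert (Qr : forall r, 0 < r < 1 -> Cmod (Q (RtoC 0)) * r ^ 4 <= 256 * (k + 1)).
  { intros r Hr.
    assert (r4 : 0 < r ^ 4) by (apply pow_lt; lra).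
    apply Rmult_le_reg_r with (/ r ^ 4); [now apply Rinv_0_lt_compat|].
    rewrite Rmult_assoc, Rinv_r, Rmult_1_r by lra.
    apply (maximum_principle Q r); [lra| | |].
    - apply Rmult_le_pos; [lra|]; now apply Rlt_le, Rinv_0_lt_compat.
    - intros z Hz; apply HQ; unfold Defs.disc; lra.
    - intros z Hz.
      assert (nz : z <> RtoC 0) by (intros ->; rewrite Cmod_0 in Hz; lra).
      apply Rmult_le_reg_r with (r ^ 4); [exact r4|].
      rewrite Rmult_assoc, Rinv_l, Rmult_1_r by lra.
      rewrite <- Hz, <- Cmod_pow, <- Cmod_mult.
      replace (Q z * z ^ 4)%C with (hankel k (comp1 w z) (comp2 w z) (comp3 w z)).
      + apply comp_hankel_le; [exact Hk | unfold Defs.disc; lra].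
      + rewrite <- (quot_pow_mult 1 (4 * c 1%nat) (comp1 w) z nz),
          <- (quot_pow_mult 2 (4 * c 2%nat) (comp2 w) z nz),
          <- (quot_pow_mult 3 (4 * c 3%nat) (comp3 w) z nz).
        unfold Q, q1, q2, q3, hankel; ring. }
  assert (L : Cmod (Q (RtoC 0)) <= 256 * (k + 1)).
  { apply Rnot_lt_le; intros L.
    set (B := 256 * (k + 1)) in *; set (A := Cmod (Q (RtoC 0))) in *.
    assert (HB : 0 < B) by (unfold B; lra).
    (* Bernoulli: (1 - e)^4 >= 1 - 4 e with e = (A - B) / (8 A) *)
    set (e := (A - B) / (8 * A)).
    assert (Ee : A * e = (A - B) / 8) by (unfold e; field; lra).
    assert (e0 : 0 < e) by (apply Rdiv_lt_0_compat; lra).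
    assert (e1 : e < 1) by (apply Rnot_le_lt; intros He; nra).
    specialize (Qr (1 - e) ltac:(lra)).
    assert (1 - 4 * e <= (1 - e) ^ 4).
    { assert ((1 - e) ^ 2 >= 1 - 2 * e) by nra.
      replace ((1 - e) ^ 4) with ((1 - e) ^ 2 * (1 - e) ^ 2) by ring.
      nra. }
    nra. }
  rewrite Q0, Cmod_mult, Cmod_R, Rabs_pos_eq in L by lra; lra.
Qed.

End Schwarz.

(** * Coefficients of functions subordinate to [G] *)

Lemma G_denominator_nz (t : R) (w : C) :
  1 / 2 < t < 1 -> Cmod w < 1 -> (1 - 2 * t * w + w ^ 2)%C <> RtoC 0.
Proof.
  intros Ht Hw E; destruct w as [x y].
  assert (N : x ^ 2 + y ^ 2 < 1).
  { pose proof (Cmod2_alt (x, y)) as E2; simpl Re in E2; simpl Im in E2.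
    pose proof (Cmod_ge_0 (x, y)); nra. }
  pose proof (f_equal fst E) as E1; pose proof (f_equal snd E) as E2; simpl in E1, E2.
  (* Both roots lie on the unit circle: [y = 0] contradicts [t ^ 2 < 1], and [x = t] forces
     [x ^ 2 + y ^ 2 = 1]. *)
  assert (Y : y * (x - t) = 0) by lra.
  assert (X : (x - t) ^ 2 + (1 - t ^ 2) = y ^ 2) by lra.
  assert (T : t ^ 2 < 1) by nra.
  apply Rmult_integral in Y; destruct Y as [Y | Y].
  - rewrite Y in X; pose proof (pow2_ge_0 (x - t)); lra.
  - assert (x = t) by lra; subst x; lra.
Qed.

(* Comparison of the coefficients of [z^2], [z^3], [z^4] in
   [f (1 - 2 t w + w^2) = z]. *)
Lemma subordination_coefs (t d : R) (f w : C -> C) (a c : nat -> C) :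
  a 0%nat = RtoC 0 -> a 1%nat = RtoC 1 -> c 0%nat = RtoC 0 -> 0 < d ->
  (forall h, Cmod h < d -> is_pseries a h (f h)) ->
  (forall h, Cmod h < d -> is_pseries c h (w h)) ->
  (forall h, Cmod h < d -> (f h * (1 - 2 * t * w h + w h ^ 2))%C = h) ->
  (a 2%nat = 2 * t * c 1%nat /\
   a 3%nat = 2 * t * c 2%nat - c 1%nat ^ 2 + 2 * t * c 1%nat * a 2%nat /\
   a 4%nat = 2 * t * c 3%nat - 2 * c 1%nat * c 2%nat
             + (2 * t * c 2%nat - c 1%nat ^ 2) * a 2%nat + 2 * t * c 1%nat * a 3%nat)%C.
Proof.
  intros a0 a1 c0 Hd Hf Hw E.
  (* The identity is compared through [h ^ 4]. Since [f] carries a factor [h], order three suffices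
     for [w]. *)
  pose proof (pseries_remainder a f d 4 Hd Hf) as Rf.
  pose proof (pseries_remainder c w d 3 Hd Hw) as Rw.
  set (p := fun h : C => (1 + a 2%nat * h + a 3%nat * h ^ 2 + a 4%nat * h ^ 3)%C).
  set (q := fun h : C => (c 1%nat * h + c 2%nat * h ^ 2 + c 3%nat * h ^ 3)%C).
  assert (Rf' : bigO 5 (fun h => (f h - h * p h)%C)).
  { eapply bigO_ext; [|exact Rf].
    intros h; unfold p; rewrite !sum_Sn, sum_O; unfold plus; simpl; rewrite a0, a1; ring. }
  assert (Rw' : bigO 4 (fun h => (w h - q h)%C)).
  { eapply bigO_ext; [|exact Rw].
    intros h; unfold q; rewrite !sum_Sn, sum_O; unfold plus; simpl; rewrite c0; ring. }
  assert (Bp : bigO 0 p) by (unfold p; bigO_bounded).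
  assert (Bq : bigO 0 q) by (unfold q; bigO_bounded).
  assert (Bw : bigO 0 w).
  { apply bigO_ext with (fun h => ((w h - q h) + q h)%C); [intros; ring|].
    apply bigO_plus; [apply (bigO_weaken 4); [lia|exact Rw'] | exact Bq]. }
  assert (BD : bigO 0 (fun h => (1 - 2 * t * w h + w h * w h)%C)).
  { repeat first [exact Bw | apply bigO_const | apply (bigO_minus 0)
      | apply (bigO_plus 0) | apply (bigO_mult 0 0)]. }
  assert (Bs : bigO 0 (fun h => (p h * (2 * t - w h - q h))%C)).
  { repeat first [exact Bw | exact Bp | exact Bq | apply bigO_const
      | apply (bigO_minus 0) | apply (bigO_mult 0 0)]. }
  (* Truncating [f] and [w] costs only fifth order: the two denominators differ by
     [(w - q)(w + q - 2 t)], which is multiplied by [h * p h]. *)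
  assert (P : bigO 5 (fun h => (h * p h * (1 - 2 * t * q h + q h ^ 2) - h)%C)).
  { apply bigO_ext_near with (fun h =>
      ((h ^ 1 * (w h - q h)) * (p h * (2 * t - w h - q h))
       - (f h - h * p h) * (1 - 2 * t * w h + w h * w h))%C) d; [exact Hd| |].
    - intros h Hh.
      transitivity (h * p h * (1 - 2 * t * q h + q h ^ 2)
        - f h * (1 - 2 * t * w h + w h ^ 2))%C; [ring | now rewrite E].
    - apply bigO_minus.
      + exact (bigO_mult 5 0 _ _ (bigO_mult 1 4 _ _ (bigO_pow 1) Rw') Bs).
      + exact (bigO_mult 5 0 _ _ Rf' BD). }
  (* The [d1] to [d6] are the coefficients of [1 - 2 t q + q ^ 2], and [e2] to [e4] those of its
     product with [h * p h]; [g] collects the orders from five on. *)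
  set (d1 := (- (2 * t * c 1%nat))%C).
  set (d2 := (- (2 * t * c 2%nat) + c 1%nat ^ 2)%C).
  set (d3 := (- (2 * t * c 3%nat) + 2 * c 1%nat * c 2%nat)%C).
  set (d4 := (2 * c 1%nat * c 3%nat + c 2%nat ^ 2)%C).
  set (d5 := (2 * c 2%nat * c 3%nat)%C).
  set (d6 := (c 3%nat ^ 2)%C).
  set (e2 := (a 2%nat + d1)%C).
  set (e3 := (a 3%nat + d2 + a 2%nat * d1)%C).
  set (e4 := (a 4%nat + d3 + a 2%nat * d2 + a 3%nat * d1)%C).
  set (g := fun h : C =>
    (d4 + a 2%nat * d3 + a 3%nat * d2 + a 4%nat * d1
     + h * (d5 + a 2%nat * d4 + a 3%nat * d3 + a 4%nat * d2
     + h * (d6 + a 2%nat * d5 + a 3%nat * d4 + a 4%nat * d3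
     + h * (a 2%nat * d6 + a 3%nat * d5 + a 4%nat * d4
     + h * (a 3%nat * d6 + a 4%nat * d5 + h * (a 4%nat * d6))))))%C).
  assert (Bg : bigO 0 g) by (unfold g; bigO_bounded).
  assert (P' : bigO 5 (fun h => (e2 * h ^ 2 + e3 * h ^ 3 + e4 * h ^ 4 + h ^ 5 * g h)%C)).
  { eapply bigO_ext; [|exact P].
    intros h; unfold e2, e3, e4, g, d1, d2, d3, d4, d5, d6, p, q; ring. }
  assert (E2 : e2 = RtoC 0).
  { apply bigO_leading_coef with 2%nat (fun h => (e3 + h * e4 + h * h * g h)%C).
    - apply (bigO_weaken 5); [lia|].
      eapply bigO_ext; [|exact P']; intros h; cbv beta; ring.
    - repeat first [exact Bg | apply bigO_const | apply bigO_id | apply (bigO_plus 0)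
        | apply (bigO_mult 0 0)]. }
  assert (E3 : e3 = RtoC 0).
  { apply bigO_leading_coef with 3%nat (fun h => (e4 + h * g h)%C).
    - apply (bigO_weaken 5); [lia|].
      eapply bigO_ext; [|exact P']; intros h; cbv beta; rewrite E2; ring.
    - repeat first [exact Bg | apply bigO_const | apply bigO_id | apply (bigO_plus 0)
        | apply (bigO_mult 0 0)]. }
  assert (E4 : e4 = RtoC 0).
  { apply bigO_leading_coef with 4%nat g; [|exact Bg].
    eapply bigO_ext; [|exact P']; intros h; cbv beta; rewrite E2, E3; ring. }
  repeat split.
  - replace (a 2%nat) with (e2 - d1)%C by (unfold e2; ring).
    rewrite E2; unfold d1; ring.
  - replace (a 3%nat) with (e3 - d2 - a 2%nat * d1)%C by (unfold e3; ring).
    rewrite E3; unfold d1, d2; ring.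
  - replace (a 4%nat) with (e4 - d3 - a 2%nat * d2 - a 3%nat * d1)%C by (unfold e4; ring).
    rewrite E4; unfold d1, d2, d3; ring.
Qed.

Theorem corollary2p1 :
  forall (t : R) (f : C -> C) (a : nat -> C),
    1 / 2 < t < 1 ->
    normalized_expansion f a ->
    N_Sigma t f ->
    Cmod (a 2%nat * a 4%nat - a 3%nat ^ 2)%C <= 8 * t ^ 2.
Proof.
  intros t f a Ht (a0 & a1 & Hf) (_ & g & r0 & _ & (_ & w & w_an & w0 & Hw) & _).
  destruct (w_an (RtoC 0)) as (c & d & Hd & Hc).
  { unfold Defs.disc; rewrite Cmod_0; lra. }
  assert (Hc' : forall h, Cmod h < d -> is_pseries c h (w h)).
  { intros h Hh; assert (E : (h - 0)%C = h) by ring.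
    rewrite <- E at 1; apply Hc; now rewrite E. }
  assert (c0 : c 0%nat = RtoC 0).
  { pose proof (bigO_at_0 _ _ (pseries_remainder c w d 0 Hd Hc')) as E.
    cbv beta in E; rewrite sum_O, w0 in E; simpl in E.
    replace (c 0%nat) with (- (0 - c 0%nat * 1))%C by ring.
    rewrite E; ring. }
  assert (f0 : f (RtoC 0) = RtoC 0).
  { assert (B : bigO 1 (fun h => (f h - sum_n (fun k => (a k * h ^ k)%C) 0)%C))
      by exact (pseries_remainder a f 1 0 Rlt_0_1 Hf).
    pose proof (bigO_at_0 _ _ B) as E.
    cbv beta in E; rewrite sum_O, a0 in E; simpl in E.
    replace (f (RtoC 0)) with (f (RtoC 0) - 0 * 1)%C by ring; exact E. }
  (* Clearing the denominator of [G] removes the case distinction at the origin. *)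
  assert (E : forall h, Cmod h < 1 -> (f h * (1 - 2 * t * w h + w h ^ 2))%C = h).
  { intros h Hh; destruct (Ceq_dec h (RtoC 0)) as [->|nz]; [rewrite f0; ring|].
    destruct (Hw h Hh) as (_ & Hlt & Eq).
    pose proof (G_denominator_nz t (w h) Ht Hlt) as Dnz.
    unfold quot, G in Eq; destruct (Ceq_dec h (RtoC 0)) as [E|_]; [easy|].
    replace (f h) with (f h / h * h)%C by (field; exact nz).
    rewrite Eq; field; exact Dnz. }
  assert (Hm : 0 < Rmin 1 d) by (apply Rmin_glb_lt; lra).
  destruct (subordination_coefs t (Rmin 1 d) f w a c a0 a1 c0 Hm) as (E2 & E3 & E4).
  - intros h Hh; apply Hf; exact (Rlt_le_trans _ _ _ Hh (Rmin_l _ _)).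
  - intros h Hh; apply Hc'; exact (Rlt_le_trans _ _ _ Hh (Rmin_r _ _)).
  - intros h Hh; apply E; exact (Rlt_le_trans _ _ _ Hh (Rmin_l _ _)).
  - assert (H : Cmod ((4 * t ^ 2)%R * (c 1%nat * c 3%nat - c 2%nat ^ 2) - c 1%nat ^ 4)%C
        <= 4 * t ^ 2 + 1).
    { apply (schwarz_hankel w c d w_an); [|exact Hd|exact Hc'|nra].
      intros z Hz; now apply Rlt_le, Hw. }
    replace (a 2%nat * a 4%nat - a 3%nat ^ 2)%C
      with ((4 * t ^ 2)%R * (c 1%nat * c 3%nat - c 2%nat ^ 2) - c 1%nat ^ 4)%C.
    (* Here [4 * t ^ 2 + 1 <= 8 * t ^ 2], because [t > 1 / 2] gives [4 * t ^ 2 > 1]. *)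
    + nra.
    + rewrite E4, E3, E2, RtoC_mult, RtoC_pow; ring.
Qed.
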